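(* Let $p,q$ be coprime integers with $q>0$, $p\neq 0$, $|p/q|<1$, and suppose that $p$ is even and $q$ is odd, or $p$ is odd and $q$ is even. Let $[b_1,b_2,\dots,b_n]$ be the canonical continued fraction for $p/q$ (all $b_i$ are nonzero even integers, positive or negative). Then the HOMFLY polynomial of the rational link $L(p/q)$ (which means the positively oriented link $L^+(p/q)$ when $q$ is even) is $$ P(L(p/q))=\sum_{c\in C} z^{k(c)}\, x_{c_s}\prod_{i\in\lambda(c)}\frac{1-a^{(-1)^{c_i-1}b_{c_i}}}{a-a^{-1}}\ \prod_{i\in\rho(c)}a^{(-1)^{c_i-1}b_{c_i}}, $$ where - $C$ is the set of all finite integer sequences $c=(c_1,c_2,\dots,c_s)$ (of any length $s=s(c)$) with $c_1>c_2>\dots>c_s$, $c_1=n$, $c_i-c_{i+1}\in\{1,2\}$ for $1\le i<s$, $c_s\in\{0,-1\}$, and such that only one of the numbers $0$ and $-1$ is present in $c$ (that is, if $c_s=-1$, then $c_{s-1}\neq 0$); - $\lambda(c)=\{i\mid 1\le i<s,\ c_i-c_{i+1}=1\}$; - $\rho(c)=\{i\mid 1\le i<s,\ c_i-c_{i+1}=2\}$; - $k(c)=|\lambda(c)|$; - $x_0=1$ and $x_{-1}=z^{-1}(a-a^{-1})$.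
   Context: **Continued fractions.** $[b_1,\dots,b_n]$ denotes $\cfrac{1}{b_1+\cfrac{1}{b_2+\cdots+\cfrac{1}{b_n}}}$. For coprime $p,q$ with $p\ne0$, $|p/q|<1$ and $pq$ even, there is a unique expansion $p/q=[b_1,\dots,b_n]$ with all $b_i$ nonzero even integers; it is called the canonical continued fraction (canonical expansion) of $p/q$. Its length $n$ is even if $q$ is odd, and odd if $q$ is even. **Natural diagrams.** For integers $b_1,\dots,b_n$ the natural diagram $D[b_1,\dots,b_n]$ is obtained as follows. Take the 4-strand braid running horizontally from left to right, with strand positions $1,2,3,4$ numbered from top to bottom, given by the word $A^{b_1}B^{b_2}A^{b_3}B^{b_4}\cdots$ ($n$ blocks, concatenated from left to right). Here $A$ is a single crossing between positions $2,3$ which is a positive crossing when both of its strands are directed left to right, and $B$ is a single crossing between positions $1,2$ which is a negative crossing when both of its strands are directed left to right; $A^{-1},B^{-1}$ are the opposite crossings. (A crossing is positive if the direction of the over-strand followed by the direction of the under-strand is a positively oriented basis of the plane.) Close the braid: on the left, join the ends in positions $1,2$ by an arc and the ends in positions $3,4$ by an arc; on the right, if $n$ is odd, join $1$ with $2$ and $3$ with $4$; if $n$ is even, join $2$ with $3$ and $1$ with $4$ (all arcs without crossings). **Rational links.** If $p/q=[b_1,\dots,b_n]$, then $L(p/q)$ is the link in $\mathbb{R}^3$ represented by $D[b_1,\dots,b_n]$; up to isotopy it does not depend on the chosen expansion. It is a knot if $q$ is odd and a two-component link if $q$ is even. If $q$ is odd, the two orientations of the knot are isotopic, so $L(p/q)$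 is regarded as an oriented knot with either orientation. If $q$ is even, the two leftmost (vertical) closing arcs belong to different components; $D^+[b_1,\dots,b_n]$ is the diagram oriented so that both leftmost arcs are directed the same way (both downward or both upward; the two choices give equivalent oriented links), and $L^+(p/q)$ is the oriented link represented by $D^+[b_1,\dots,b_n]$. It may be computed from the canonical expansion. **HOMFLY polynomial.** $P$ is the Laurent polynomial invariant of oriented links in variables $a,z$ determined by $P(\bigcirc)=1$ for the unknot and $aP(L_+)-a^{-1}P(L_-)=zP(L_0)$, where $L_+,L_-,L_0$ are oriented links that coincide outside a ball and inside it are, respectively, a positive crossing, a negative crossing and its orientation-preserving smoothing. For even $m$ the fraction $(1-a^{m})/(a-a^{-1})$ is a Laurent polynomial in $a$. *)

(* Defs.v *)
From HB Require Import structures.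
From Stdlib Require Import Relation_Operators.
From mathcomp Require Import all_boot all_order all_algebra fraction.
From mathcomp Require Import classical_sets fsbigop.
Set Implicit Arguments.
Unset Strict Implicit.
Unset Printing Implicit Defensive.
Import Order.TTheory GRing.Theory Num.Theory.
Local Open Scope ring_scope.

(** * Link diagrams

  A link diagram is swept by a vertical line moving from left to right and is
  written as the word of the elementary events met by the line.  The points of
  the diagram on the line are numbered from top to bottom, starting at 0 (so
  the strand positions 1, 2, 3, 4 of a 4-braid are 0, 1, 2, 3 here).
  - [Birth i t]: an arc "(" opens and creates the points i and i+1;
  - [Death i]: an arc ")" closes and joins the points i and i+1;
  - [Cross i s]: the strands at i and i+1 cross; the over-strand is the
    descending one (top left to bottom right) if [s] is true, and the ascending
    one (bottom left to top right) if [s] is false.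
  The label of a birth is in [unit] for an unoriented diagram.  For an oriented
  diagram it is the direction of the upper point of the arc, where [true] means
  "left to right"; its lower point has the opposite direction.  The labels of
  the births determine the orientation of the whole diagram. *)

Inductive event (T : Type) : Type :=
| Birth of nat & T
| Death of nat
| Cross of nat & bool.
Arguments Death {T}.
Arguments Cross {T}.

Definition erase_event (T : Type) (e : event T) : event unit :=
  match e with
  | Birth i _ => Birth i tt
  | Death i => Death i
  | Cross i s => Cross i s
  end.

Definition erase (T : Type) (w : seq (event T)) : seq (event unit) :=
  map (@erase_event T) w.

(* [st] lists the directions of the points on the sweeping line; the result is
   [None] if the event is impossible there (missing points, or a death joining
   two strands with the same direction). *)
Definition act (e : event bool) (st : seq bool) : option (seq bool) :=
  match e with
  | Birth i d =>
      if (i <= size st)%N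
      then Some (take i st ++ [:: d; ~~ d] ++ drop i st) else None
  | Death i =>
      if (i.+1 < size st)%N && (nth true st i != nth true st i.+1)
      then Some (take i st ++ drop i.+2 st) else None
  | Cross i _ =>
      if (i.+1 < size st)%N
      then Some (take i st ++ [:: nth true st i.+1; nth true st i]
                 ++ drop i.+2 st)
      else None
  end.

Definition run (w : seq (event bool)) (st : seq bool) : option (seq bool) :=
  foldl (fun o e => obind (act e) o) (Some st) w.

Definition closed_word (w : seq (event bool)) : bool := run w [::] == Some [::].

Record link_diagram := LinkDiagram {
  word :> seq (event bool);
  word_closed : closed_word word
}.

HB.instance Definition _ := [isSub for word].

(** * Isotopy *)

Definition pos (T : Type) (e : event T) : nat :=
  match e with Birth i _ => i | Death i => i | Cross i _ => i end.

Definition set_pos (T : Type) (e : event T) (j : nat) : event T :=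
  match e with
  | Birth _ t => Birth j t
  | Death _ => Death j
  | Cross _ s => Cross j s
  end.

Definition inputs (T : Type) (e : event T) : nat :=
  if e is Birth _ _ then 0 else 2.

Definition outputs (T : Type) (e : event T) : nat :=
  if e is Death _ then 0 else 2.

(* The Reidemeister moves and the plane isotopies of diagrams written as words
   of events (the oriented form of the Freyd-Yetter-Turaev moves): two link
   diagrams represent isotopic oriented links if and only if they are related
   by a finite sequence of these moves and their inverses. *)
Inductive local_move : seq (event bool) -> seq (event bool) -> Prop :=
| far_commutation e f : (pos e + inputs e <= pos f)%N ->
    local_move [:: f; e] [:: e; set_pos f (pos f - inputs e + outputs e)]
| zigzag_down i d : local_move [:: Birth i.+1 d; Death i] [::]
| zigzag_up i d : local_move [:: Birth i d; Death i.+1] [::]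
| slide_birth i d s :
    local_move [:: Birth i.+1 d; Cross i s] [:: Birth i d; Cross i.+1 (~~ s)]
| slide_death i s :
    local_move [:: Cross i s; Death i.+1] [:: Cross i.+1 (~~ s); Death i]
| reidemeister1_birth i d s :
    local_move [:: Birth i d; Cross i s] [:: Birth i (~~ d)]
| reidemeister1_death i s : local_move [:: Cross i s; Death i] [:: Death i]
| reidemeister2 i s : local_move [:: Cross i s; Cross i (~~ s)] [::]
(* The side condition says that the three strands lie at three levels, i.e.
   that "passes over" is not cyclic. *)
| reidemeister3 i s1 s2 s3 : (s2 == s1) || (s2 == s3) ->
    local_move [:: Cross i s1; Cross i.+1 s2; Cross i s3]
               [:: Cross i.+1 s3; Cross i s2; Cross i.+1 s1].

Definition diagram_move (D E : link_diagram) : Prop :=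
  exists u x y v : seq (event bool),
    [/\ local_move x y, word D = u ++ x ++ v & word E = u ++ y ++ v].

Definition isotopic : link_diagram -> link_diagram -> Prop :=
  clos_refl_sym_trans link_diagram diagram_move.

(** * The HOMFLY polynomial *)

(* The field Q(a, z), which contains Z[a, a^-1, z, z^-1]. *)
Definition ratfun := {fraction {poly {poly int}}}.
Definition va : ratfun := tofrac ('X%:P).
Definition vz : ratfun := tofrac 'X.

Definition is_laurent (f : ratfun) : Prop :=
  exists (g : {poly {poly int}}) (k l : nat), f = tofrac g / (va ^+ k * vz ^+ l).

(* [t1] and [t2] are the directions of the strands entering from the left at
   the top (the descending strand) and at the bottom (the ascending one).  If
   both are directed left to right, they are (1,-1) and (1,1), and
   det((1,-1),(1,1)) > 0: the crossing is positive iff the descending strand is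
   over.  Reversing one strand changes the sign. *)
Definition positive_crossing (t1 t2 s : bool) : bool := s == (t1 == t2).

(* If one strand is directed to the right and the other one to the left, the
   orientation-preserving smoothing is ")(", otherwise it is two parallel
   strands. *)
Definition smoothing (i : nat) (t1 t2 : bool) : seq (event bool) :=
  if t1 == t2 then [::] else [:: Death i; Birth i t2].

Definition skein_triple (Dp Dm D0 : link_diagram) : Prop :=
  exists (u v : seq (event bool)) (st : seq bool) (i : nat) (s : bool),
    let t1 := nth true st i in
    let t2 := nth true st i.+1 in
    [/\ run u [::] = Some st /\ (i.+1 < size st)%N,
        positive_crossing t1 t2 s,
        word Dp = u ++ [:: Cross i s] ++ v,
        word Dm = u ++ [:: Cross i (~~ s)] ++ v
      & word D0 = u ++ smoothing i t1 t2 ++ v].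

Lemma unknot_closed (d : bool) : closed_word [:: Birth 0 d; Death 0].
Proof. by case: d. Qed.

Definition unknot (d : bool) : link_diagram := LinkDiagram (unknot_closed d).

Definition is_homfly (P : link_diagram -> ratfun) : Prop :=
  [/\ forall D, is_laurent (P D),
      forall D E, isotopic D E -> P D = P E,
      forall d, P (unknot d) = 1
    & forall Dp Dm D0, skein_triple Dp Dm D0 ->
        va * P Dp - va^-1 * P Dm = vz * P D0].

(** * Rational links *)

Fixpoint cfrac (b : seq int) : rat :=
  if b is x :: b' then (x%:~R + cfrac b')^-1 else 0.

Definition canonical_expansion (p q : int) (b : seq int) : Prop :=
  all (fun x : int => (x != 0) && (2 %| x)%Z) b /\
  cfrac b = p%:~R / q%:~R.

(* A^x and B^x; when both strands are directed left to right, A is positive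
   (descending strand over) and B is negative (ascending strand over). *)
Definition braidA (x : int) : seq (event unit) := nseq `|x|%N (Cross 1 (0 <= x)).
Definition braidB (x : int) : seq (event unit) := nseq `|x|%N (Cross 0 (x < 0)).

Fixpoint braid (isA : bool) (b : seq int) : seq (event unit) :=
  if b is x :: b' then
    (if isA then braidA x else braidB x) ++ braid (~~ isA) b'
  else [::].

Definition natural_diagram (b : seq int) : seq (event unit) :=
  [:: Birth 0 tt; Birth 2 tt] ++ braid true b ++
  (if odd (size b) then [:: Death 2; Death 0] else [:: Death 1; Death 0]).

(* The two leftmost arcs are directed the same way. *)
Definition positively_oriented (w : seq (event bool)) : bool :=
  if w is Birth _ d1 :: Birth _ d2 :: _ then d1 == d2 else false.

(* [D] is a diagram of L(p/q) if q is odd (with either orientation), and of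
   L^+(p/q) if q is even. *)
Definition rational_link (p q : int) (D : link_diagram) : Prop :=
  exists (b : seq int) (E : link_diagram),
    [/\ canonical_expansion p q b,
        erase E = natural_diagram b,
        (2 %| q)%Z -> positively_oriented E
      & isotopic E D].

(** * The right-hand side *)

(* Entries numbered from 1. *)
Definition entry (s : seq int) (i : nat) : int := nth 0 s i.-1.

Definition Cset (n : nat) : set (seq int) :=
  [set c : seq int |
    [/\ (0 < size c)%N /\ entry c 1 = n%:Z,
        forall i : nat, (1 <= i < size c)%N -> entry c i.+1 < entry c i,
        forall i : nat, (1 <= i < size c)%N ->
          entry c i - entry c i.+1 = 1 \/ entry c i - entry c i.+1 = 2,
        entry c (size c) = 0 \/ entry c (size c) = -1
      & ~ (0 \in c /\ -1 \in c)]]%classic.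

Definition lam (c : seq int) : seq nat :=
  [seq i <- iota 1 (size c).-1 | entry c i - entry c i.+1 == 1].
Definition rho (c : seq int) : seq nat :=
  [seq i <- iota 1 (size c).-1 | entry c i - entry c i.+1 == 2].

(* The exponent (-1)^(j-1) b_j, for 1 <= j <= n. *)
Definition expo (b : seq int) (j : int) : int :=
  (-1) ^ (j - 1) * entry b `|j|%N.

(* Only used at j = 0 and j = -1. *)
Definition xval (j : int) : ratfun :=
  if j == 0 then 1 else vz^-1 * (va - va^-1).

(* Main.v *)
Require Import Defs.
From HB Require Import structures.
From mathcomp Require Import all_boot all_order all_algebra fraction.
From mathcomp Require Import classical_sets fsbigop.
From mathcomp Require Import ring lra zify.
From Stdlib Require Import Relation_Operators.
Import Order.TTheory GRing.Theory Num.Theory.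
Local Open Scope ring_scope.

(** Let [P_n] be the value of the invariant on the natural diagram of the first
    [n] entries of the canonical expansion, and let [e_n = (-1)^(n-1) b_n].
    Since every entry is even, the braid is pure, and since the two left arcs have
    the same direction, the strands of every block are antiparallel all along the
    block.  The skein relation applied to the last block removes two of its
    crossings or smooths one of them, and summing a geometric progression gives
    the value as a combination of the values of two simpler diagrams, the one
    without the block and the one where the block is smoothed ([wval_twist]).
    Smoothing leaves the natural diagram with [n - 1] entries, and deleting the
    last block makes the block before it untwist, which leaves [n - 2] entries.
    Hence

      [P_n = z (1 - a^e_n) / (a - a^-1) P_(n-1) + a^e_n P_(n-2)]

    with [P_0 = 1] (the unknot) and [P_(-1) = z^-1 (a - a^-1)] (the two-component
    unlink); this is [stage_valueSS].

    The right-hand side is the expansion of this recurrence: a sequence in [C]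
    records which of the two terms is chosen at each step, a step of length 1
    having the first weight and a step of length 2 the second one.  The sequences
    starting at [n] are thus obtained from those starting at [n - 1] and at
    [n - 2], and the sum satisfies the same recurrence ([path_sumSS]).

    It remains to see that a diagram of the rational link is the diagram treated
    above.  The canonical expansion is unique ([cfrac_inj]), and the two left arcs
    have the same direction ([orientation_unique]): if [n] is even, the closing
    arcs on the right force it, and if [n] is odd, then [q] is even
    ([cfrac_parity]) and the orientation is the positive one by convention. *)

Local Notation even_seq := (all (fun x : int => 2 %| x)%Z).
Local Notation nz_even_seq := (all (fun x : int => (x != 0) && (2 %| x)%Z)).

(** * Running words of events *)

Lemma run_cat u v st : run (u ++ v) st = obind (run v) (run u st).
Proof.
rewrite /run foldl_cat; case: (foldl _ (Some st) u) => //=.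
by elim: v.
Qed.

Lemma run_cons e w st : run (e :: w) st = obind (run w) (act e st).
Proof. exact: (run_cat [:: e] w st). Qed.

Lemma act_birth l r d :
  act (Birth (size l) d) (l ++ r) = Some (l ++ d :: ~~ d :: r).
Proof. by rewrite /= size_cat leq_addr take_size_cat // drop_size_cat. Qed.

(** The positions of the two points that an event touches are written as
    [size l] and [size l + 1] in a state [l ++ x :: y :: r]; this turns the
    indices of [act] into list surgery. *)
Lemma nth_mid l x y r :
  nth true (l ++ x :: y :: r) (size l) = x /\
  nth true (l ++ x :: y :: r) (size l).+1 = y.
Proof. by rewrite !nth_cat ltnn subnn ltnNge leqnSn subSnn. Qed.

Lemma drop_mid T l (x y : T) r : drop (size l).+2 (l ++ x :: y :: r) = r.
Proof. by elim: l => //=; rewrite drop0. Qed.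

Lemma ltn_mid T l (x y : T) r : ((size l).+1 < size (l ++ x :: y :: r))%N.
Proof. by rewrite size_cat /= !addnS !ltnS leq_addr. Qed.

Lemma act_death l x y r :
  act (Death (size l)) (l ++ x :: y :: r) =
  if x != y then Some (l ++ r) else None.
Proof.
have [nx ny] := nth_mid l x y r.
by rewrite /act ltn_mid nx ny take_size_cat // drop_mid.
Qed.

Lemma act_cross l x y r s :
  act (Cross (size l) s) (l ++ x :: y :: r) = Some (l ++ y :: x :: r).
Proof.
have [nx ny] := nth_mid l x y r.
by rewrite /act ltn_mid nx ny take_size_cat // drop_mid.
Qed.

Lemma split_at i (st : seq bool) : (i.+1 < size st)%N ->
  exists l x y r, size l = i /\ st = l ++ x :: y :: r.
Proof.
move=> lt_i; have szi : size (take i st) = i by rewrite size_take; case: ltnP; lia.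
have : (1 < size (drop i st))%N by rewrite size_drop; lia.
case E: (drop i st) => [//|x [//|y r]] _.
by exists (take i st), x, y, r; rewrite -E cat_take_drop.
Qed.

Lemma run_crosses l x y r k s :
  run (nseq k (Cross (size l) s)) (l ++ x :: y :: r) =
  Some (if odd k then l ++ y :: x :: r else l ++ x :: y :: r).
Proof.
elim: k x y => // k IHk x y.
by rewrite run_cons act_cross /= IHk; case: odd.
Qed.

Lemma run_even_crosses i k s st : (i.+1 < size st)%N -> ~~ odd k ->
  run (nseq k (Cross i s)) st = Some st.
Proof.
move=> /split_at[l [x [y [r [<- ->]]]]] /negbTE odd_k.
by rewrite run_crosses odd_k.
Qed.

(** * Link invariants evaluated on words *)

(** Extending [P] by 0 to the words that do not close up makes the moves and the
    skein relation hold for words without any closedness condition: the words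
    involved act in the same way on states, so they close up together. *)
Definition wval (P : link_diagram -> ratfun) (w : seq (event bool)) : ratfun :=
  if insub w is Some D then P D else 0.

Lemma wvalE P (D : link_diagram) : wval P D = P D.
Proof. by rewrite /wval valK. Qed.

Lemma wval_closed P w (h : closed_word w) : wval P w = P (LinkDiagram h).
Proof. exact: (wvalE P (LinkDiagram h)). Qed.

Lemma wval_open P w : ~~ closed_word w -> wval P w = 0.
Proof. by move=> h; rewrite /wval insubN. Qed.

Lemma closed_subst u x y v :
  obind (run x) (run u [::]) = obind (run y) (run u [::]) ->
  closed_word (u ++ x ++ v) = closed_word (u ++ y ++ v).
Proof. by rewrite /closed_word !catA !(run_cat _ v) !(run_cat u) => ->. Qed.

(** A link diagram move needs both sides to be closed; it is enough that the two
    local pieces have the same effect on the state that reaches them. *)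
Lemma wval_move {P} (hP : is_homfly P) u x y v :
  local_move x y ->
  obind (run x) (run u [::]) = obind (run y) (run u [::]) ->
  wval P (u ++ x ++ v) = wval P (u ++ y ++ v).
Proof.
move=> xy run_xy; have [_ isoP _ _] := hP.
case: (boolP (closed_word (u ++ x ++ v))) => cx; last first.
  by rewrite !wval_open // -(closed_subst _ _ _ _ run_xy).
have cy : closed_word (u ++ y ++ v) by rewrite -(closed_subst _ _ _ _ run_xy).
rewrite !wval_closed; apply: isoP; apply: rst_step.
by exists u, x, y, v.
Qed.

(** At a crossing of two antiparallel strands, the ascending strand is over
    ([Cross _ false]) exactly when the crossing is positive, and the oriented
    smoothing is a cap followed by a cup. *)
Lemma wval_skein {P} (hP : is_homfly P) u v l x r :
  run u [::] = Some (l ++ x :: ~~ x :: r) ->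
  va * wval P (u ++ [:: Cross (size l) false] ++ v)
    - va^-1 * wval P (u ++ [:: Cross (size l) true] ++ v) =
  vz * wval P (u ++ [:: Death (size l); Birth (size l) (~~ x)] ++ v).
Proof.
move=> run_u; have [_ _ _ skeinP] := hP.
have run_smooth s : obind (run [:: Cross (size l) s]) (run u [::]) =
    obind (run [:: Death (size l); Birth (size l) (~~ x)]) (run u [::]).
  rewrite run_u [LHS]run_cons [RHS]run_cons act_cross act_death.
  by case: (x) => /=; rewrite run_cons act_birth.
case: (boolP (closed_word (u ++ [:: Cross (size l) false] ++ v))) => c1.
  have c0 := c1; rewrite (closed_subst _ _ _ _ (run_smooth false)) in c0.
  have c2 := c0; rewrite -(closed_subst _ _ _ _ (run_smooth true)) in c2.
  rewrite !wval_closed; apply: skeinP.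
  have [nx ny] := nth_mid l x (~~ x) r.
  exists u, v, (l ++ x :: ~~ x :: r), (size l), false; rewrite /= nx ny.
  split=> //; first by rewrite ltn_mid.
  - by rewrite /positive_crossing; case: (x).
  - by rewrite /smoothing; case: (x).
have c0 := c1; rewrite (closed_subst _ _ _ _ (run_smooth false)) in c0.
have c2 := c0; rewrite -(closed_subst _ _ _ _ (run_smooth true)) in c2.
by rewrite !wval_open // !mulr0 subrr.
Qed.

(** * Twisting two antiparallel strands *)

Lemma wval_kinks_death {P} (hP : is_homfly P) u i s k v :
  wval P (u ++ nseq k (Cross i s) ++ Death i :: v) = wval P (u ++ Death i :: v).
Proof.
elim: k => // k <-; rewrite -[k.+1]addn1 nseqD -catA.
rewrite [LHS](_ : _ = wval P ((u ++ nseq k (Cross i s)) ++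
  [:: Cross i s; Death i] ++ v)); last by rewrite -!catA.
rewrite (wval_move hP _ _ [:: Death i]) -?catA //; first exact: reidemeister1_death.
case: (run _ _) => //= st; rewrite run_cons.
have [/split_at[l [x [y [r [<- ->]]]]]|ge_i] := ltnP i.+1 (size st).
  by rewrite act_cross /= run_cons [RHS]run_cons !act_death eq_sym.
by rewrite run_cons /= ltnNge ge_i.
Qed.

(** Each first Reidemeister move exchanges the ends of the arc, hence reverses
    the direction of its upper end. *)
Lemma wval_kinks_birth {P} (hP : is_homfly P) u i x s k v :
  wval P (u ++ Birth i x :: nseq k (Cross i s) ++ v) =
  wval P (u ++ Birth i (x (+) odd k) :: v).
Proof.
elim: k x => [|k IHk] x; first by rewrite addbF.
rewrite -[_ :: _ ++ v]/([:: Birth i x; Cross i s] ++ (nseq k (Cross i s) ++ v)).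
rewrite (wval_move hP _ _ [:: Birth i (~~ x)]); first 1 last.
- exact: reidemeister1_birth.
- case: (run _ _) => //= st; rewrite run_cons [RHS]run_cons.
  have [le_i|lt_i] := leqP i (size st); last by rewrite /= leqNgt lt_i.
  have [l [r [<- ->]]] : exists l r, size l = i /\ st = l ++ r.
    exists (take i st), (drop i st); rewrite cat_take_drop size_take.
    by split=> //; case: ltnP le_i; lia.
  by rewrite !act_birth /= run_cons act_cross negbK.
by rewrite IHk addNb -addbN.
Qed.

(** [e] crossings, counted with sign: the sign convention is that of [A], and it
    makes the skein exponent of antiparallel strands equal to [e]. *)
Definition twist i (e : int) : seq (event bool) := nseq `|e|%N (Cross i (0 <= e)).

Lemma va_neq0 : va != 0.
Proof. by rewrite tofrac_eq0 polyC_eq0 polyX_eq0. Qed.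

Lemma vz_neq0 : vz != 0.
Proof. by rewrite tofrac_eq0 polyX_eq0. Qed.

Lemma va_subV_neq0 : va - va^-1 != 0.
Proof.
apply/eqP => h; have : va * (va - va^-1) == 0 by rewrite h mulr0.
rewrite mulrBr divff ?va_neq0 // -expr2 subr_eq0 -tofracXn -tofrac1 tofrac_eq.
rewrite -polyC_exp -polyC1 => /eqP/polyC_inj/(congr1 (fun p : {poly int} => size p)).
by rewrite size_polyXn size_poly1.
Qed.

Lemma sub_inv_neq0 (F : fieldType) (a : F) :
  a != 0 -> a - a^-1 != 0 -> a ^+ 2 - 1 != 0.
Proof. by move=> a0 a1; rewrite expr2 -(divff a0) -mulrBr mulf_neq0. Qed.

(** The skein relation solved for the diagram [W1] with two more crossings than
    [W]: each use of it adds one term of a geometric progression to the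
    coefficient of the smoothed diagram [S], and [(1 - t) / (a - a^-1)] is the
    sum of that progression. *)
Lemma skein_solve_pos (F : fieldType) (a z W W0 W1 S : F) k :
  a != 0 -> a - a^-1 != 0 -> a * W1 - a^-1 * W = z * S ->
  W = a^-1 ^+ k * W0 + z * ((1 - a^-1 ^+ k) / (a - a^-1)) * S ->
  W1 = a^-1 ^+ k.+2 * W0 + z * ((1 - a^-1 ^+ k.+2) / (a - a^-1)) * S.
Proof.
move=> a0 a1; rewrite !exprSr; move: (a^-1 ^+ k) => t skein W_E.
have -> : W1 = a^-1 * (a^-1 * W + z * S) by rewrite -skein; field.
by rewrite W_E; field; rewrite a0 sub_inv_neq0.
Qed.

Lemma skein_solve_neg (F : fieldType) (a z W W0 W1 S : F) k :
  a != 0 -> a - a^-1 != 0 -> a * W - a^-1 * W1 = z * S ->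
  W = a ^+ k * W0 + z * ((1 - a ^+ k) / (a - a^-1)) * S ->
  W1 = a ^+ k.+2 * W0 + z * ((1 - a ^+ k.+2) / (a - a^-1)) * S.
Proof.
move=> a0 a1; rewrite !exprSr; move: (a ^+ k) => t skein W_E.
have -> : W1 = a * (a * W - z * S) by rewrite -skein; field.
by rewrite W_E; field; rewrite a0 sub_inv_neq0.
Qed.

(** Changing the first of two adjacent equal crossings cancels both, and
    smoothing it turns all the other crossings into kinks; so the value [W k]
    with [2k] crossings satisfies a first-order linear recurrence whose
    inhomogeneous term, the value of the smoothed diagram, does not depend
    on [k]. *)
Lemma wval_twist_nat {P} (hP : is_homfly P) u v l x r s k :
  run u [::] = Some (l ++ x :: ~~ x :: r) ->
  let t := (if s then va else va^-1) ^+ k.*2 in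
  wval P (u ++ nseq k.*2 (Cross (size l) s) ++ v) =
  t * wval P (u ++ v) + vz * ((1 - t) / (va - va^-1)) *
    wval P (u ++ Death (size l) :: Birth (size l) x :: v).
Proof.
move=> run_u /=; set i := size l.
set Wsm := wval P (u ++ Death i :: Birth i x :: v).
elim: k => [|k]; first by rewrite expr0 subrr !mul0r mulr0 mul0r addr0 mul1r.
set w := nseq k.*2 _ ++ v => IHk.
rewrite -[nseq _ _ ++ v]/([:: Cross i s] ++ Cross i s :: w).
have smooth : wval P (u ++ [:: Death i; Birth i (~~ x)] ++ Cross i s :: w) = Wsm.
  have := wval_kinks_birth hP (u ++ [:: Death i]) i (~~ x) s k.*2.+1 v.
  by rewrite -!catA /= odd_double addbT negbK.
have cancel : wval P (u ++ [:: Cross i (~~ s)] ++ Cross i s :: w) = wval P (u ++ w).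
  apply: (wval_move hP u [:: Cross i (~~ s); Cross i s] [::] w).
    by have := reidemeister2 i (~~ s); rewrite negbK.
  by rewrite run_u [LHS]run_cons act_cross /= run_cons act_cross.
have := wval_skein hP u (Cross i s :: w) l x r run_u; rewrite smooth.
case: s @w IHk cancel {smooth} => /= IHk -> E.
  exact: skein_solve_neg va_neq0 va_subV_neq0 E IHk.
exact: skein_solve_pos va_neq0 va_subV_neq0 E IHk.
Qed.

Lemma wval_twist {P} (hP : is_homfly P) u v l x r e :
  run u [::] = Some (l ++ x :: ~~ x :: r) -> (2 %| e)%Z ->
  wval P (u ++ twist (size l) e ++ v) =
  va ^ e * wval P (u ++ v) + vz * ((1 - va ^ e) / (va - va^-1)) *
    wval P (u ++ Death (size l) :: Birth (size l) x :: v).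
Proof.
move=> run_u; rewrite dvdzE /= dvdn2 => even_e; rewrite /twist.
rewrite -[`|e|%N]odd_double_half (negbTE even_e) add0n.
rewrite (wval_twist_nat hP u v l x r _ _ run_u).
suff -> : (if 0 <= e then va else va^-1) ^+ (`|e|./2).*2 = va ^ e by [].
rewrite -[X in _ ^+ X]add0n -[X in _ ^+ (X + _)]/(nat_of_bool false).
rewrite -(negbTE even_e) odd_double_half.
by case: e {even_e} => n; rewrite ?exprVn.
Qed.

(** * Natural diagrams *)

Definition orient d (e : event unit) : event bool :=
  match e with
  | Birth i _ => Birth i d
  | Death i => Death i
  | Cross i s => Cross i s
  end.

Definition oriented_diagram d (b : seq int) : seq (event bool) :=
  map (orient d) (natural_diagram b).

(** The natural diagram without its right closing arcs. *)
Definition open_braid d (b : seq int) : seq (event bool) :=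
  [:: Birth 0 d; Birth 2 d] ++ map (orient d) (braid true b).

Lemma oriented_diagramE d b :
  oriented_diagram d b = open_braid d b ++ [:: Death (odd (size b)).+1; Death 0].
Proof.
by rewrite /oriented_diagram /natural_diagram !map_cat catA; case: odd.
Qed.

(** A block of [B]'s has the opposite sign convention, which is where the sign
    [(-1) ^ (j - 1)] of the exponents comes from. *)
Lemma map_orient_block d t x :
  map (orient d) (if t then braidA x else braidB x) =
  twist t (if t then x else - x).
Proof.
rewrite /twist /braidA /braidB; case: t; rewrite map_nseq //= abszN.
by rewrite oppr_ge0 le_eqVlt; case: eqP => [->|].
Qed.

Lemma open_braid_rcons d b x :
  open_braid d (rcons b x) =
  open_braid d b ++ twist (~~ odd (size b)) ((-1) ^+ size b * x).
Proof.
rewrite /open_braid -catA; congr (_ ++ _).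
rewrite -signr_odd -[~~ _]/(true (+) odd (size b)).
rewrite [_ * x](_ : _ = if true (+) odd (size b) then x else - x); last first.
  by case: odd; rewrite /= ?expr1 ?expr0 ?mulN1r ?mul1r.
elim: b true => [|y b IHb] t /=.
  by rewrite cats0 addbF map_orient_block.
by rewrite !map_cat IHb -catA addNb addbN.
Qed.

Lemma odd_absz_even (x : int) : (2 %| x)%Z -> ~~ odd `|x|%N.
Proof. by rewrite dvdzE dvdn2. Qed.

Lemma run_even_braid d t b st : even_seq b -> (2 < size st)%N ->
  run (map (orient d) (braid t b)) st = Some st.
Proof.
move=> + lt2; elim: b t => //= x b IHb t /andP[even_x even_b].
rewrite map_cat map_orient_block run_cat /twist run_even_crosses //= ?IHb //.
  by case: (t) => //; lia.
by apply: odd_absz_even; case: (t) => //; rewrite rpredN.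
Qed.

(** All blocks being even, the braid is pure, so the directions at its right end
    are those of the two left arcs; in particular all its crossings join
    antiparallel strands. *)
Lemma run_open_braid d b : even_seq b ->
  run (open_braid d b) [::] = Some [:: d; ~~ d; d; ~~ d].
Proof. by move=> eb; rewrite /open_braid run_cat /= run_even_braid. Qed.

(** The two right closing arcs for odd length may be drawn in either order; the
    second one puts the arc that closes 1 with 2 right after the braid, where it
    meets a final block of [B]'s. *)
Lemma wval_caps {P} (hP : is_homfly P) u :
  wval P (u ++ [:: Death 2; Death 0]) = wval P (u ++ [:: Death 0; Death 0]).
Proof.
have := wval_move hP u [:: Death 2; Death 0] [:: Death 0; Death 0] [::].
rewrite !cats0; apply.
  exact: (@far_commutation (Death 0) (Death 2)).
case: (run _ _) => //= -[|a [|b [|c [|e r]]]] //=.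
- by case: a b => [] [].
- by case: a b => [] [].
by case: a b c e => [] [] [] []; rewrite /run /= ?drop0.
Qed.

Lemma wval_unknot {P} (hP : is_homfly P) d : wval P [:: Birth 0 d; Death 0] = 1.
Proof. by have [_ _ P1 _] := hP; rewrite -(P1 d) -(wvalE P (unknot d)). Qed.

(** The unlink with two components: a diagram with a single kink is an
    unknot for both signs of its crossing, and its smoothing is the unlink. *)
Lemma wval_two_caps {P} (hP : is_homfly P) d :
  wval P [:: Birth 0 d; Birth 2 d; Death 2; Death 0] = vz^-1 * (va - va^-1).
Proof.
apply: (etrans (wval_caps hP [:: Birth 0 d; Birth 2 d])).
apply: (etrans (wval_move hP [:: Birth 0 d] [:: Birth 2 d; Death 0]
  [:: Death 0; Birth 0 d] [:: Death 0] _ _)).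
- exact: (@far_commutation (Death 0) (Birth 2 d)).
- by case: d.
apply: (etrans (esym (wval_move hP [:: Birth 0 d; Death 0]
  [:: Birth 0 (~~ d); Cross 0 true] [:: Birth 0 d] [:: Death 0] _ _))).
- by have := reidemeister1_birth 0 (~~ d) true; rewrite negbK.
- by case: d.
apply: (etrans (wval_move hP [:: Birth 0 d; Death 0; Birth 0 (~~ d)]
  [:: Cross 0 true; Death 0] [:: Death 0] [::] _ _)).
- exact: reidemeister1_death.
- by case: d.
have := wval_skein hP [:: Birth 0 d] [:: Death 0] [::] d [::] erefl.
have crossed s : wval P ([:: Birth 0 d] ++ [:: Cross 0 s] ++ [:: Death 0]) = 1.
  rewrite -(wval_unknot hP d).
  apply: (wval_move hP [:: Birth 0 d] [:: Cross 0 s; Death 0] [:: Death 0] [::]).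
    exact: reidemeister1_death.
  by case: d.
by rewrite !crossed !mulr1 => ->; rewrite mulKf ?vz_neq0.
Qed.

(** The empty expansion: the two arcs on the left form a zigzag with the
    inner arc on the right. *)
Lemma wval_no_twists {P} (hP : is_homfly P) d :
  wval P (oriented_diagram d [::]) = 1.
Proof.
rewrite -(wval_unknot hP d).
apply: (wval_move hP [:: Birth 0 d] [:: Birth 2 d; Death 1] [::] [:: Death 0]).
  exact: zigzag_down.
by case: d.
Qed.

(** The twist formula for the last block.  Smoothing a crossing of this block
    cuts the braid in front of it, and the arc left over forms a zigzag with the
    closing arc; what remains is the shorter braid closed in the way that its
    length requires. *)
Lemma wval_last_block {P} (hP : is_homfly P) d b x :
  even_seq b -> (2 %| x)%Z ->
  let y := va ^ ((-1) ^+ size b * x) in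
  wval P (oriented_diagram d (rcons b x)) =
  y * wval P (open_braid d b ++ [:: Death (~~ odd (size b)).+1; Death 0]) +
  vz * ((1 - y) / (va - va^-1)) * wval P (oriented_diagram d b).
Proof.
move=> even_b even_x.
have run_u := run_open_braid d b even_b.
rewrite !oriented_diagramE open_braid_rcons size_rcons oddS -catA.
set e := _ * x; have even_e : (2 %| e)%Z by rewrite dvdz_mull.
move: (open_braid d b) run_u => u run_u.
suff [l [z [r [size_l run_l zig]]]] : exists l z r,
    [/\ size l = (~~ odd (size b)), run u [::] = Some (l ++ z :: ~~ z :: r) &
    wval P (u ++ [:: Death (~~ odd (size b)); Birth (~~ odd (size b)) z;
                     Death (~~ odd (size b)).+1; Death 0]) =
    wval P (u ++ [:: Death (odd (size b)).+1; Death 0])].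
  by rewrite -zig -size_l (wval_twist hP _ _ _ _ _ _ run_l).
case: (odd (size b)).
  (* a final block of [B]'s, between the points 0 and 1 *)
  exists [::], d, [:: d; ~~ d]; split=> //.
  rewrite wval_caps //.
  have := wval_move hP (u ++ [:: Death 0]) [:: Birth 0 d; Death 1] [::] [:: Death 0].
  rewrite -!catA; apply; first exact: zigzag_up.
  by rewrite run_cat run_u /=; case: d {run_u}.
(* a final block of [A]'s, between the points 1 and 2 *)
exists [:: d], (~~ d), [:: ~~ d]; split=> //; first by rewrite negbK.
have := wval_move hP (u ++ [:: Death 1]) [:: Birth 1 (~~ d); Death 2] [::]
  [:: Death 0].
rewrite -!catA; apply; first exact: zigzag_up.
by rewrite run_cat run_u /=; case: d {run_u}.
Qed.

(** With the last block removed but the closing arcs kept, the crossings of the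
    block before it lie next to a closing arc, and untwist as kinks. *)
Lemma wval_drop_block {P} (hP : is_homfly P) d b x :
  wval P (open_braid d (rcons b x) ++ [:: Death (~~ odd (size b).+1).+1; Death 0]) =
  wval P (oriented_diagram d b).
Proof.
rewrite oriented_diagramE open_braid_rcons -catA oddS negbK.
rewrite /twist; case: (odd (size b)); last exact: wval_kinks_death.
apply: etrans (esym (wval_caps hP _)).
rewrite catA; apply: (etrans (wval_caps hP _)).
by rewrite -catA; apply: wval_kinks_death.
Qed.

(** The value for the first [k - 1] entries of [b], where length -1 (that is,
    [k = 0]) stands for the two-component unlink: this is the closure of odd type
    of the braid without crossings, and with it the recurrence below covers the
    expansions of length 1. *)
Definition stage_value P d (b : seq int) (k : nat) : ratfun :=
  if k is k'.+1 then wval P (oriented_diagram d (take k' b))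
  else vz^-1 * (va - va^-1).

Lemma stage_valueSS {P} (hP : is_homfly P) d b k :
  even_seq b -> (k < size b)%N ->
  let y := va ^ ((-1) ^+ k * nth 0 b k) in
  stage_value P d b k.+2 =
  y * stage_value P d b k + vz * ((1 - y) / (va - va^-1)) * stage_value P d b k.+1.
Proof.
move=> even_b lt_k /=.
have even_take j : even_seq (take j b).
  by apply/allP=> z /mem_take; apply/allP.
have := wval_last_block hP d (take k b) (nth 0 b k) (even_take k).
rewrite -take_nth // size_takel ?(ltnW lt_k) // => -> //; last first.
  by have /allP := even_b; apply; apply: mem_nth.
congr (_ * _ + _); case: k lt_k => [_|k lt_k] /=.
  by rewrite take0 -(wval_two_caps hP d).
rewrite (take_nth 0) 1?ltnW // -(wval_drop_block hP d _ (nth 0 b k)).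
by rewrite size_takel // -ltnS; do 2 apply: ltnW.
Qed.

(** * The index sequences *)

(** The condition that defines [Cset], with an integer as first entry so that
    tails of sequences are covered, down to the sequence [-1]. *)
Definition admissible (m : int) (c : seq int) : Prop :=
  [/\ (0 < size c)%N /\ entry c 1 = m,
      forall i : nat, (1 <= i < size c)%N -> entry c i.+1 < entry c i,
      forall i : nat, (1 <= i < size c)%N ->
        entry c i - entry c i.+1 = 1 \/ entry c i - entry c i.+1 = 2,
      entry c (size c) = 0 \/ entry c (size c) = -1
    & ~ (0 \in c /\ -1 \in c)].

Lemma admissible_head m x c : admissible m (x :: c) -> x = m.
Proof. by case=> -[]. Qed.

Lemma admissible_seq1 m x : admissible m [:: x] <-> x = m /\ (x = 0 \/ x = -1).
Proof.
split=> [[[_ xm] _ _ end_x _]|[xm end_x]]; first by split.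
split=> //; try by move=> [|i].
by rewrite !inE => -[/eqP <- /eqP].
Qed.

Lemma admissible_tail m x y c :
  admissible m (x :: y :: c) -> admissible y (y :: c).
Proof.
case=> _ decr step end_c ne; split=> // [i|i|[c0 cN1]].
- by case: i => // i lt_i; apply: (decr i.+2).
- by case: i => // i lt_i; apply: (step i.+2).
- by apply: ne; rewrite in_cons c0 orbT in_cons cN1 orbT.
Qed.

Lemma admissible_step m x y c : admissible m (x :: y :: c) ->
  x - y = 1 \/ x - y = 2.
Proof. by case=> _ _ step _ _; apply: (step 1%N). Qed.

Lemma admissible_geN1 m c : admissible m c -> -1 <= m.
Proof.
elim: c m => [|x [|y c] IHc] m; first by case=> -[].
  by case/admissible_seq1=> <- [] ->.
move=> adm; have <- := admissible_head _ _ _ adm.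
have := IHc _ (admissible_tail _ _ _ _ adm).
have := admissible_step _ _ _ _ adm; lia.
Qed.

(** The last condition of [admissible] only constrains nonpositive entries, so
    it says nothing new about a positive first entry. *)
Lemma admissible_cons m x y c : 0 < m ->
  admissible m (x :: y :: c) <->
  [/\ x = m, x - y = 1 \/ x - y = 2 & admissible y (y :: c)].
Proof.
move=> m_gt0; split=> [adm|[xm step_xy [_ decr step end_c ne]]].
  split; first exact: (admissible_head _ _ _ adm).
    exact: admissible_step adm.
  exact: admissible_tail adm.
split=> //.
- move=> [|[|i]] // lt_i; last by apply: (decr i.+1).
  rewrite /entry /=; lia.
- by move=> [|[|i]] // lt_i; apply: (step i.+1).
- move=> [c0 cN1]; apply: ne; split.
    by move: c0; rewrite inE; case: eqP => //= *; lia.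
  by move: cN1; rewrite inE; case: eqP => //= *; lia.
Qed.

(** Below 1 the only possible step is from 0 to -1, which the last condition
    of [admissible] forbids. *)
Lemma admissible_le0 m c : m <= 0 -> admissible m c ->
  c = [:: m] /\ (m = 0 \/ m = -1).
Proof.
case: c => [|x [|y c]] m_le0; first by case=> -[].
  by case/admissible_seq1=> <-.
move=> adm; have xm := admissible_head _ _ _ adm.
have := admissible_step _ _ _ _ adm.
have y_ge := admissible_geN1 _ _ (admissible_tail _ _ _ _ adm) => step.
case: adm => _ _ _ _ []; have [-> ->] : x = 0 /\ y = -1 by lia.
by rewrite !inE eqxx orbT.
Qed.

(** The admissible sequences starting at [k - 1]; the shift makes both final
    entries, -1 and 0, natural indices. *)
Fixpoint descents (k : nat) : seq (seq int) :=
  match k with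
  | 0 => [:: [:: -1]]
  | 1 => [:: [:: 0]]
  | (k2.+1 as k1).+1 => map (cons (Posz k1)) (descents k1 ++ descents k2)
  end.

Arguments descents : simpl never.

Lemma descentsSS k :
  descents k.+2 = map (cons k.+1%:Z) (descents k.+1 ++ descents k).
Proof. by []. Qed.

Lemma mem_descents k c : c \in descents k <-> admissible (k%:Z - 1) c.
Proof.
elim/ltn_ind: k c => -[|[|k]] IHk c.
- rewrite inE; split=> [/eqP ->|/admissible_le0[]// ->//].
  by apply/admissible_seq1; split=> //; right.
- rewrite inE; split=> [/eqP ->|/admissible_le0[]// ->//].
  by apply/admissible_seq1; split=> //; left.
have m_gt0 : 0 < k.+2%:Z - 1 :> int by lia.
rewrite descentsSS; split=> [/mapP[c' c'_in ->{c}]|].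
  have [y adm step] :
      exists2 y, admissible y c' & k.+1%:Z - y = 1 \/ k.+1%:Z - y = 2.
    move: c'_in; rewrite mem_cat => /orP[] /IHk adm.
      by exists (k.+1%:Z - 1); [apply: adm | left; lia].
    by exists (k%:Z - 1); [apply: adm | right; lia].
  case: c' {c'_in} adm => [[[]]//|z c' adm].
  have yz := admissible_head _ _ _ adm; subst z.
  by apply/admissible_cons => //; split=> //; lia.
case: c => [[[]]//|x [/admissible_seq1[]|y c]]; first lia.
case/admissible_cons=> // xm step adm.
have -> : x = k.+1%:Z by lia.
apply: map_f; rewrite mem_cat; apply/orP.
case: step => step; [left|right]; apply/IHk => //.
  by have -> : k.+1%:Z - 1 = y :> int by lia.
by have -> : k%:Z - 1 = y :> int by lia.
Qed.

Lemma uniq_descents k : uniq (descents k).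
Proof.
elim/ltn_ind: k => -[|[|k]] IHk //.
rewrite descentsSS map_inj_uniq => [|? ? []//].
rewrite cat_uniq !IHk // andbT /=; apply/hasPn => c /mem_descents adm.
apply/negP => c_in; have /mem_descents adm1 : c \in descents k.+1 := c_in.
by have [[_ h] _ _ _ _] := adm; have [[_ h1] _ _ _ _] := adm1; lia.
Qed.

Definition path_weight (b c : seq int) : ratfun :=
  vz ^+ size (lam c) * xval (entry c (size c)) *
  (\prod_(i <- lam c) ((1 - va ^ expo b (entry c i)) / (va - va^-1))) *
  (\prod_(i <- rho c) va ^ expo b (entry c i)).

(** Common to [lam] (gap 1) and [rho] (gap 2). *)
Lemma filter_gap_cons g x y c :
  [seq i <- iota 1 (size (y :: c)) |
     entry (x :: y :: c) i - entry (x :: y :: c) i.+1 == g] =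
  (if x - y == g then [:: 1%N] else [::]) ++
  map S [seq i <- iota 1 (size (y :: c)).-1 |
           entry (y :: c) i - entry (y :: c) i.+1 == g].
Proof.
have iota2 : iota 2 (size c) = map S (iota 1 (size c)) := iotaDl 1 1 _.
rewrite -[iota 1 (size (y :: c))]/(1%N :: iota 2 (size c)) iota2.
rewrite -[1%N :: _]/([:: 1%N] ++ _) filter_cat filter_map; congr (_ ++ map _ _).
by apply: eq_in_filter => -[|i]; rewrite ?mem_iota.
Qed.

(** The factors of a term are local: the first gap contributes one factor and
    the tail contributes its own term. *)
Lemma path_weight_cons b x y c :
  path_weight b (x :: y :: c) =
  (if x - y == 1 then vz * ((1 - va ^ expo b x) / (va - va^-1)) else 1) *
  (if x - y == 2 then va ^ expo b x else 1) * path_weight b (y :: c).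
Proof.
have entryS i : i \in iota 1 (size c) -> entry (x :: y :: c) i.+1 = entry (y :: c) i.
  by case: i; rewrite ?mem_iota.
have big_shift g (F : int -> ratfun) :
    \prod_(i <- map S [seq i <- iota 1 (size c) |
           entry (y :: c) i - entry (y :: c) i.+1 == g])
       F (entry (x :: y :: c) i) =
    \prod_(i <- [seq i <- iota 1 (size c) |
           entry (y :: c) i - entry (y :: c) i.+1 == g]) F (entry (y :: c) i).
  rewrite big_map; apply: eq_big_seq => i; rewrite mem_filter => /andP[_ i_in].
  by rewrite entryS.
rewrite /path_weight /lam /rho !filter_gap_cons /= !big_cat /= !size_cat size_map.
rewrite (big_shift 1 (fun j => (1 - va ^ expo b j) / (va - va^-1))).
rewrite (big_shift 2 (fun j => va ^ expo b j)).
rewrite [entry (x :: _) _]/(entry (y :: c) (size c).+1) exprD.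
case: eqP => _; case: eqP => _; rewrite ?big_nil ?big_seq1 /=.
all: rewrite -?[entry (x :: y :: c) 1]/x.
all: move: (xval _) (vz ^+ size [seq _ <- _ | _]).
all: move: (\prod_(i <- _) _) (\prod_(i <- _) _).
all: move: (va ^ expo b x) => A R L X Z.
all: by rewrite ?expr1 ?expr0; ring.
Qed.

Lemma expoS b k : expo b k.+1%:Z = (-1) ^+ k * nth 0 b k.
Proof. by rewrite /expo intS addrAC subrr add0r. Qed.

Definition path_sum b k : ratfun := \sum_(c <- descents k) path_weight b c.

Lemma path_weight_seq1 b x : path_weight b [:: x] = xval x.
Proof. by rewrite /path_weight !big_nil expr0 mul1r !mulr1. Qed.

Lemma path_sumSS b k :
  let y := va ^ ((-1) ^+ k * nth 0 b k) in
  path_sum b k.+2 =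
  y * path_sum b k + vz * ((1 - y) / (va - va^-1)) * path_sum b k.+1.
Proof.
rewrite -expoS /= /path_sum descentsSS big_map big_cat addrC /= !mulr_sumr.
congr (_ + _); apply: eq_big_seq => -[|y c] in_c;
  have adm := (mem_descents _ _).1 in_c; try by case: adm => -[].
- have -> : y = k.+1%:Z - 1 by have := admissible_head _ _ _ adm; lia.
  rewrite path_weight_cons (_ : k.+1%:Z - _ = 1); last by lia.
  by rewrite eqxx (_ : (1 == 2 :> int) = false) // mulr1.
- have -> : y = k%:Z - 1 by have := admissible_head _ _ _ adm; lia.
  rewrite path_weight_cons (_ : k.+1%:Z - _ = 2); last by lia.
  by rewrite eqxx (_ : (2 == 1 :> int) = false) // mul1r.
Qed.

(** Both sides satisfy the same second-order recurrence with the same initial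
    values, the unlink against [x_{-1}] and the unknot against [x_0]. *)
Lemma stage_value_path_sum {P} (hP : is_homfly P) d b k :
  even_seq b -> (k <= (size b).+1)%N -> stage_value P d b k = path_sum b k.
Proof.
move=> even_b; elim/ltn_ind: k => -[|[|k]] IHk le_k.
- by rewrite /path_sum big_seq1 path_weight_seq1.
- by rewrite /path_sum big_seq1 path_weight_seq1 /= take0 wval_no_twists.
by rewrite stage_valueSS // path_sumSS !IHk //; lia.
Qed.

Lemma Cset_descents n : Cset n = [set` descents n.+1]%classic.
Proof.
have mem c : c \in descents n.+1 <-> admissible n%:Z c.
  by have := mem_descents n.+1 c; rewrite (_ : n.+1%:Z - 1 = n%:Z) //; lia.
by apply/seteqP; split=> c /mem.
Qed.

(** * Canonical expansions *)

(** The absolute value of a nonzero even integer is at least 2, so it stays above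
    1 when a number of absolute value below 1 is added. *)
Lemma cfrac_lt1 b : nz_even_seq b -> `|cfrac b| < 1.
Proof.
elim: b => [|x b IHb] /=; first by rewrite normr0.
case/andP=> /andP[x_neq0 even_x] /IHb lt1.
have x_ge2 : (2 : rat) <= `|x%:~R|.
  rewrite -intr_norm (ler_int _ 2).
  by move: even_x x_neq0; rewrite dvdzE; case: x => -[|[|n]] //=; lia.
have gt1 : 1 < `|x%:~R + cfrac b|.
  have := lerB_normD x%:~R (cfrac b); lra.
by rewrite normfV invf_lt1 // (lt_trans ltr01).
Qed.

Lemma cfrac_cons_neq0 x b : nz_even_seq (x :: b) -> x%:~R + cfrac b != 0.
Proof.
case/andP=> /andP[x_neq0 even_x] /cfrac_lt1 lt1; apply/eqP => eq0.
have : `|x%:~R| < 1 :> rat.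
  by rewrite -normrN (_ : - _ = cfrac b) //; lra.
by rewrite -intr_norm (ltr_int _ _ 1); lia.
Qed.

(** The first entry is determined: it is an even integer at distance less than 1
    from the inverse of the fraction, and two such integers differ by less
    than 2. *)
Lemma cfrac_inj b c :
  nz_even_seq b -> nz_even_seq c -> cfrac b = cfrac c -> b = c.
Proof.
elim: b c => [|x b IHb] [|y c] // eb ec.
- by move=> /esym/eqP; rewrite invr_eq0 (negbTE (cfrac_cons_neq0 _ _ ec)).
- by move=> /eqP; rewrite invr_eq0 (negbTE (cfrac_cons_neq0 _ _ eb)).
move=> /invr_inj E0.
have E : x%:~R + cfrac b = y%:~R + cfrac c := E0.
move: eb ec => /= /andP[/andP[_ ex] eb] /andP[/andP[_ ey] ec].
have xy : x = y.
  have : `|(x - y)%:~R| < 2 :> rat.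
    rewrite rmorphB /= (_ : _ - _ = cfrac c - cfrac b); last by lra.
    apply: le_lt_trans (ler_normB _ _) _.
    have := cfrac_lt1 _ eb; have := cfrac_lt1 _ ec; lra.
  rewrite -intr_norm (ltr_int _ _ 2); lia.
by rewrite xy (IHb c) //; move: E; rewrite xy => /addrI.
Qed.

(** Adding an even integer to [M / N] preserves the parities of numerator and
    denominator, and inverting exchanges them. *)
Lemma cfrac_parity b : nz_even_seq b ->
  exists M N : int, [/\ N != 0, cfrac b = M%:~R / N%:~R,
    (2 %| M)%Z = ~~ odd (size b) & (2 %| N)%Z = odd (size b)].
Proof.
elim: b => [|x b IHb] eb; first by exists 0, 1; rewrite mul0r.
have neq0 := cfrac_cons_neq0 _ _ eb; move: eb => /= /andP[/andP[_ ex] eb].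
have [M [N [N_neq0 b_MN parM parN]]] := IHb eb.
have NQ : N%:~R != 0 :> rat by rewrite intr_eq0.
have eqD : x%:~R + cfrac b = (x * N + M)%:~R / N%:~R.
  by rewrite b_MN rmorphD rmorphM /= mulrDl mulfK.
exists N, (x * N + M); split; rewrite ?negbK //.
- by apply: contraNneq neq0; rewrite eqD => ->; rewrite mul0r.
- by rewrite eqD invf_div.
- by rewrite rpredDl ?dvdz_mulr // parM.
Qed.

(** * Orientations of natural diagrams *)

Definition not_birth T (e : event T) : bool :=
  if e is Birth _ _ then false else true.

Lemma erase_birth_free d (w : seq (event bool)) (v : seq (event unit)) :
  all (@not_birth unit) v ->
  erase w = v -> w = map (orient d) v.
Proof.
move=> free_v E; move: free_v; rewrite -{}E /erase.
by elim: w => //= -[i t|i|i s] w IHw //= /IHw <-.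
Qed.

(** For even length the closing arc 2-3 forces the two left arcs to have the same
    direction; for odd length this is the positive orientation. *)
Lemma orientation_unique b (E : link_diagram) : even_seq b ->
  erase E = natural_diagram b -> (odd (size b) -> positively_oriented E) ->
  exists d, word E = oriented_diagram d b.
Proof.
move=> even_b; have := word_closed E; case: (word E) => [|e1 [|e2 w]] //.
case: e1 => // i1 d1; case: e2 => // i2 d2 closed_w [i1E i2E erase_w] pos_w.
subst i1 i2.
have free : all (@not_birth unit) (braid true b ++
    (if odd (size b) then [:: Death 2; Death 0] else [:: Death 1; Death 0])).
  rewrite all_cat; apply/andP; split; last by case: odd.
  elim: (b) true => //= x c IHc t; rewrite all_cat IHc andbT.
  by case: t; rewrite /= ?/braidA ?/braidB all_nseq orbT.
exists d1; rewrite /oriented_diagram /=.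
rewrite (erase_birth_free d1 _ _ free erase_w) in closed_w pos_w *.
suff -> : d2 = d1 by [].
case odd_b : (odd (size b)) closed_w pos_w => closed_w; first by move/(_ isT)/eqP.
move=> _; move: closed_w; rewrite /closed_word.
rewrite (run_cat [:: Birth 0 d1; Birth 2 d2]) map_cat /=.
by rewrite run_cat run_even_braid //=; case: d1 d2 => [] [].
Qed.

(** * The HOMFLY polynomial of rational links *)

Theorem theorem1 (P : link_diagram -> ratfun) (hP : is_homfly P)
  (p q : int) (hcop : coprimez p q) (hq : 0 < q) (hp : p != 0)
  (hlt : `|p%:~R / q%:~R : rat| < 1)
  (hpar : ((2 %| p)%Z /\ ~~ (2 %| q)%Z) \/ (~~ (2 %| p)%Z /\ (2 %| q)%Z))
  (b : seq int) (hb : canonical_expansion p q b)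
  (D : link_diagram) (hD : rational_link p q D) :
  P D =
  \sum_(c \in Cset (size b))
    (vz ^+ size (lam c) * xval (entry c (size c)) *
     (\prod_(i <- lam c) ((1 - va ^ expo b (entry c i)) / (va - va^-1))) *
     (\prod_(i <- rho c) va ^ expo b (entry c i))).
Proof.
have [nz_even_b b_pq] := hb.
have [b' [E [[nz_even_b' b'_pq] E_nat E_pos isoED]]] := hD.
have b'b : b' = b by apply: cfrac_inj => //; rewrite b_pq b'_pq.
subst b'.
have even_b : even_seq b by apply: sub_all nz_even_b => x /andP[].
have odd_q : odd (size b) -> (2 %| q)%Z.
  move=> odd_b; have [M [N [N_neq0 b_MN parM parN]]] := cfrac_parity _ nz_even_b.
  have /eqP : M%:~R / N%:~R = p%:~R / q%:~R :> rat by rewrite -b_MN.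
  rewrite eqr_div ?intr_eq0 ?(gt_eqF hq) // -!rmorphM /= eqr_int => /eqP MqpN.
  have : (2 %| M * q)%Z by rewrite MqpN dvdz_mull // parN.
  rewrite !dvdzE abszM Euclid_dvdM // -!dvdzE => /orP[|//].
  by rewrite parM odd_b.
have [d E_d] := orientation_unique b E even_b E_nat (fun h => E_pos (odd_q h)).
have [_ isoP _ _] := hP.
rewrite -(isoP _ _ isoED) -(wvalE P E) E_d Cset_descents.
rewrite -[RHS](fsbig_seq _ (path_weight b)) ?uniq_descents //.
rewrite -[RHS]/(path_sum b (size b).+1) -(stage_value_path_sum hP d) //=.
by rewrite take_size.
Qed.
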